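(* Let $\mathcal{F}$ be a hereditary and pointwise closed family of finite subsets of $\mathbb{N}$, let $M$ be an infinite subset of $\mathbb{N}$, let $(\mathcal{A}_\zeta)_{\zeta<\omega_1}$ be a system of uniform families on $M$, and set $\xi=\sup\{s_L(\mathcal{F}):L\in[M]\}$. Then $\xi$ is a countable ordinal and the following hold: (i) For every ordinal $\zeta$ with $\zeta+1<\xi$ there exists $L\in[M]$ such that $(\mathcal{A}_\zeta)_{*}\cap[L]^{<\omega}\subseteq\mathcal{F}$. (ii) For every countable ordinal $\zeta$ with $\xi<\zeta+1$ and every $M_1\in[M]$ there exists $L\in[M_1]$ such that $\mathcal{F}\cap[L]^{<\omega}\subseteq(\mathcal{A}_\zeta)^{*}\setminus\mathcal{A}_\zeta$, which gives that $\mathcal{A}_\zeta\cap[L]^{<\omega}\subseteq[\mathbb{N}]^{<\omega}\setminus\mathcal{F}$. (iii) If $\xi=\zeta+1$, then there exists $M_1\in[M]$ such that $s_{M_1}(\mathcal{F})=\xi$, and there exists $L\in[M_1]$ such that either $(\mathcal{A}_\zeta)_{*}\cap[L]^{<\omega}\subseteq\mathcal{F}$ or $\mathcal{F}\cap[L]^{<\omega}\subseteq(\mathcal{A}_\zeta)^{*}\setminus\mathcal{A}_\zeta$. Both alternatives may materialize: there are instances of $\mathcal{F}$, $M$, $(\mathcal{A}_\zeta)_{\zeta<\omega_1}$ with $\xi=\zeta+1$ in which the first alternative occurs, and instances in which the second occurs.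
   Context: $\mathbb{N}=\{1,2,3,\dots\}$. For an infinite $M\subseteq\mathbb{N}$, $[M]^{<\omega}$ is the set of all finite subsets of $M$ and $[M]$ the set of all infinite subsets of $M$. For finite sets, $s<t$ means $\max s<\min t$ (vacuously true if one of them is empty). A family is hereditary if it contains every subset of each of its elements. Subsets of $\mathbb{N}$ are identified with their characteristic functions and the set of all subsets of $\mathbb{N}$ carries the topology of pointwise convergence; closed and cluster point refer to it. For a family $\mathcal{L}$ of finite sets, $\mathcal{L}^{*}$ is the family of all initial segments (not necessarily proper, including $\emptyset$) of elements of $\mathcal{L}$, and $\mathcal{L}_{*}$ is the family of all subsets of elements of $\mathcal{L}$. Uniform families. Let $M\in[\mathbb{N}]$ and $\mathcal{L}\subseteq[M]^{<\omega}$. For $m\in M$ put $\mathcal{L}(m)=\{s\in[M]^{<\omega}:\{m\}\cup s\in\mathcal{L}\text{ and }\{m\}<s\}$. For countable ordinals $\xi$, ''$\mathcal{L}$ is $\xi$-uniform on $M$'' is defined recursively: (1) $\mathcal{L}$ is $0$-uniform on $M$ if $\mathcal{L}=\{\emptyset\}$; (2) if $\xi=\zeta+1$, $\mathcal{L}$ is $\xi$-uniform on $M$ if $\emptyset\notin\mathcal{L}$ and $\mathcal{L}(m)$ is $\zeta$-uniform on $M\cap(m,+\infty)$ for every $m\in M$; (3) if $\xi$ is a nonzero limit ordinal, $\mathcal{L}$ is $\xi$-uniform on $M$ if $\emptyset\notin\mathcal{L}$ and there is an increasing sequence $(\xi_m)_{m\in M}$ of ordinals smaller than $\xi$ with $\sup_m\xi_m=\xi$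 such that $\mathcal{L}(m)$ is $\xi_m$-uniform on $M\cap(m,+\infty)$ for every $m\in M$. A collection $(\mathcal{A}_\xi)_{\xi<\omega_1}$ of subfamilies of $[M]^{<\omega}$ is a system of uniform families on $M$ if each $\mathcal{A}_\xi$ is $\xi$-uniform on $M$ and, for every $m\in M$ and $1\le\xi<\omega_1$, $\mathcal{A}_\xi(m)=\mathcal{A}_{\xi_m}\cap[(m,+\infty)]^{<\omega}$, where $\xi_m+1=\xi$ if $\xi$ is a successor, and $(\xi_m)_{m\in M}$ is an increasing sequence of ordinals smaller than $\xi$ with $\sup_m\xi_m=\xi$ if $\xi$ is a limit ordinal. Strong Cantor–Bendixson index. For a hereditary and pointwise closed family $\mathcal{F}$ of finite subsets of $\mathbb{N}$ and $M\in[\mathbb{N}]$, write $\mathcal{F}[M]=\mathcal{F}\cap[M]^{<\omega}$, put $(\mathcal{F})^0_M=\mathcal{F}[M]$ and $$(\mathcal{F})^1_M=\{A\in\mathcal{F}[M]: A\text{ is a cluster point of }\mathcal{F}[A\cup L]\text{ for each }L\in[M]\};$$ $(\mathcal{F})^{\xi+1}_M=((\mathcal{F})^{\xi}_M)^1_M$; and $(\mathcal{F})^{\xi}_M=\bigcap_{\beta<\xi}(\mathcal{F})^{\beta}_M$ for limit $\xi$. The index $s_M(\mathcal{F})$ is the smallest countable ordinal $\xi$ with $(\mathcal{F})^{\xi}_M=\emptyset$. *)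

(* Defs.v *)
From HB Require Import structures.
From mathcomp Require Import all_boot all_order.
From mathcomp Require Import boolp classical_sets functions cardinality wochoice.
From mathcomp Require Import topology cantor.

Set Implicit Arguments.
Unset Strict Implicit.
Unset Printing Implicit Defensive.
Import Order.TTheory.

Local Open Scope order_scope.
Local Open Scope classical_set_scope.

(** [omega1] is the set of points with countably many predecessors in some
    well-ordering of the uncountable type [nat -> bool].  The order type is
    pinned down by [omega1_wf], [omega1_countable_seg] and
    [omega1_uncountable]: an uncountable well-order all of whose proper initial
    segments are countable is isomorphic to the first uncountable ordinal. *)

Definition wo_rel : rel (nat -> bool) :=
  projT1 (well_ordering_principle (nat -> bool : eqType)).

Record omega1 : Type := Omega1 {
  omega1_val : nat -> bool;
  omega1_valP : countable [set y | wo_rel y omega1_val /\ y <> omega1_val]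
}.

Lemma wo_relP : well_order wo_rel.
Proof. exact: projT2 (well_ordering_principle _). Qed.

Lemma wo_rel_chain : wo_chain wo_rel xpredT.
Proof. by move=> A _; exact: wo_relP. Qed.

Lemma wo_rel_total : total wo_rel.
Proof. by move=> x y; exact: (wo_chainW wo_rel_chain). Qed.

Lemma wo_rel_refl : reflexive wo_rel.
Proof. by move=> x; exact: (wo_chain_reflexive wo_rel_chain). Qed.

Lemma wo_rel_anti : antisymmetric wo_rel.
Proof. by move=> x y; exact: (wo_chain_antisymmetric wo_rel_chain). Qed.

Lemma wo_rel_min (A : set (nat -> bool)) : A !=set0 ->
  exists2 z, A z & forall y, A y -> wo_rel z y.
Proof.
move=> [x Ax].
have [|z [[/asboolP Az zmin] _]] := wo_relP (A := fun u => `[< A u >]).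
  by exists x; apply/asboolP.
by exists z => // y Ay; apply: zmin; apply/asboolP.
Qed.

Lemma wo_rel_trans : transitive wo_rel.
Proof.
move=> y x z xy yz.
have [|w Aw wmin] := @wo_rel_min [set u | u = x \/ u = y \/ u = z].
  by exists x; left.
have wx : wo_rel w x by apply: wmin; left.
have wy : wo_rel w y by apply: wmin; right; left.
have wz : wo_rel w z by apply: wmin; right; right.
case: Aw => [wE|[wE|wE]]; first by rewrite -wE.
  rewrite wE in wx; have xy' : x = y by apply: wo_rel_anti; rewrite xy wx.
  by rewrite xy'.
rewrite wE in wy; have yz' : y = z by apply: wo_rel_anti; rewrite yz wy.
by rewrite -yz'.
Qed.

Lemma omega1_val_inj : injective omega1_val.
Proof.
move=> [x hx] [y hy] /= xy; move: hx hy; rewrite xy => hx hy.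
by rewrite (Prop_irrelevance hx hy).
Qed.

HB.instance Definition _ := gen_eqMixin omega1.
HB.instance Definition _ := gen_choiceMixin omega1.

Definition omega1_le (x y : omega1) : bool :=
  wo_rel (omega1_val x) (omega1_val y).

Lemma omega1_le_refl : reflexive omega1_le.
Proof. by move=> x; exact: wo_rel_refl. Qed.

Lemma omega1_le_anti : antisymmetric omega1_le.
Proof. by move=> x y xy; apply: omega1_val_inj; exact: wo_rel_anti. Qed.

Lemma omega1_le_trans : transitive omega1_le.
Proof. by move=> y x z; exact: wo_rel_trans. Qed.

Lemma omega1_le_total : total omega1_le.
Proof. by move=> x y; exact: wo_rel_total. Qed.

Fact omega1_display : Order.disp_t. Proof. exact: Order.Disp tt tt. Qed.

HB.instance Definition _ := Order.Le_isPOrder.Build omega1_display omega1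
  omega1_le_refl omega1_le_anti omega1_le_trans.
HB.instance Definition _ :=
  Order.POrder_isTotal.Build omega1_display omega1 omega1_le_total.

Lemma omega1_min (A : set omega1) : A !=set0 -> exists2 z, A z & lbound A z.
Proof.
move=> [x Ax]; have [|_ [z Az <-] zmin] := @wo_rel_min (omega1_val @` A).
  by exists (omega1_val x), x.
by exists z => // y Ay; apply: zmin; exists y.
Qed.

Lemma omega1_wf : well_founded (fun x y : omega1 => x < y).
Proof.
move=> x; apply: contrapT => nx.
have [|z nz zmin] := @omega1_min [set u | ~ Acc (fun x y : omega1 => x < y) u].
  by exists x.
apply: nz; constructor => y yz; apply: contrapT => /zmin zy.
by move: (lt_le_trans yz zy); rewrite ltxx.
Qed.

Lemma omega1_countable_seg (x : omega1) : countable [set y | y < x].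
Proof.
have /pcard_injP[f finj] := omega1_valP x.
apply/pcard_injP; exists (f \o omega1_val) => a b.
have val_lt c : c < x ->
    wo_rel (omega1_val c) (omega1_val x) /\ omega1_val c <> omega1_val x.
  rewrite lt_neqAle => /andP[/eqP cx clex]; split=> // e.
  by apply: cx; exact: omega1_val_inj.
rewrite !inE /= => /val_lt ax /val_lt bx e.
by apply: omega1_val_inj; apply: finj => //; rewrite inE.
Qed.

Lemma omega1_uncountable : ~ countable [set: omega1].
Proof.
move=> cW.
pose I := range omega1_val.
have cI : countable I.
  by move: cW; apply: sub_countable; exact: card_image_le.
have [|z nIz zmin] := @wo_rel_min (~` I).
  apply: contrapT => /set0P/negP/negPn/eqP/(congr1 (@setC _)).
  rewrite setCK setC0 => IT; rewrite IT in cI.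
  move/pcard_injP : cI => [f finj].
  pose d n := ~~ `[< exists2 u : nat -> bool, f u = n & u n >].
  have dE : d (f d) = ~~ `[< exists2 u : nat -> bool, f u = f d & u (f d) >] by [].
  case: (pselect (exists2 u : nat -> bool, f u = f d & u (f d))) => [ex|nex].
    have [u fu ud] := ex; move: ud.
    by rewrite (_ : u = d) ?dE ?asboolT//; apply: finj; rewrite ?inE.
  by apply: (nex); exists d => //; rewrite dE asboolF.
apply: nIz; have cz : countable [set y | wo_rel y z /\ y <> z].
  apply: sub_countable cI; apply: subset_card_le => y [yz ynz].
  apply: contrapT => /zmin zy; apply: ynz.
  by apply: wo_rel_anti; rewrite yz zy.
by exists (Omega1 cz).
Qed.

Lemma omega1_inhabited : exists x : omega1, True.
Proof.
apply: contrapT => nex; apply: omega1_uncountable.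
suff -> : [set: omega1] = set0 by exact: countable0.
by rewrite -subset0 => x _; apply: nex; exists x.
Qed.

HB.instance Definition _ := isPointed.Build omega1 (projT1 (cid omega1_inhabited)).

(* The least element of a nonempty set of countable ordinals; an arbitrary
   value on [set0]. *)
Definition least (A : set omega1) : omega1 := get (A `&` lbound A).

Lemma leastP (A : set omega1) : A !=set0 -> A (least A) /\ lbound A (least A).
Proof.
move=> /omega1_min[z Az zmin].
exact: (@getI _ (A `&` lbound A) z (conj Az zmin)).
Qed.

Definition ozero : omega1 := least [set: omega1].

Definition osucc (x : omega1) : omega1 := least [set y | x < y].

Definition olimit (x : omega1) : Prop :=
  x <> ozero /\ forall y, x <> osucc y.

Lemma ozero_le (x : omega1) : ozero <= x.
Proof. by have [_] := leastP (ex_intro setT x I); exact. Qed.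

Lemma osuccP (x : omega1) :
  x < osucc x /\ forall y, x < y -> osucc x <= y.
Proof.
apply: (@leastP [set y | x < y]); apply: contrapT => nex.
apply: omega1_uncountable.
suff -> : [set: omega1] = [set y | y < x] `|` [set x].
  rewrite -bigcup2E; apply: bigcup_countable; first exact: countableP.
  by case=> [|[|n]] _ /=; [exact: omega1_countable_seg|exact: countable1|].
apply/seteqP; split => // y _ /=.
have [yx|xy|->] := ltgtP y x; [by left| |by right].
by exfalso; apply: nex; exists y.
Qed.

Definition Npos : set nat := [set n | (0 < n)%N].

Definition above (m : nat) : set nat := [set n | (m < n)%N].

Definition fins (M : set nat) : set (set nat) :=
  [set s | finite_set s /\ s `<=` M].

Definition infs (M : set nat) : set (set nat) :=
  [set L | infinite_set L /\ L `<=` M].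

Definition before (s t : set nat) : Prop :=
  forall i j, s i -> t j -> (i < j)%N.

Definition hereditary (F : set (set nat)) : Prop :=
  forall s t, F s -> t `<=` s -> F t.

Definition initial_segment (s t : set nat) : Prop :=
  s `<=` t /\ before s (t `\` s).

Definition initials (L : set (set nat)) : set (set nat) :=
  [set s | exists2 t, L t & initial_segment s t].

Definition subsets (L : set (set nat)) : set (set nat) :=
  [set s | exists2 t, L t & s `<=` t].

(* The topology of pointwise convergence is that of the product
   [cantor_space].  The sets of positive integers form a closed subspace, so
   being closed, or a limit point, means the same in it. *)
Definition chi (A : set nat) : cantor_space := fun n => `[< A n >].

Definition pointwise_closed (F : set (set nat)) : Prop := closed (chi @` F).

Definition cluster_point (F : set (set nat)) (A : set nat) : Prop :=
  limit_point (chi @` F) (chi A).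

Definition section (M : set nat) (L : set (set nat)) (m : nat) :
    set (set nat) :=
  [set s | [/\ fins M s, L ([set m] `|` s) & before [set m] s]].

(* The sequences attached to a limit ordinal are strictly increasing on [M]. *)
Definition ladder (M : set nat) (xi : omega1) (e : nat -> omega1) : Prop :=
  [/\ forall m n, M m -> M n -> (m < n)%N -> e m < e n,
      forall m, M m -> e m < xi
    & supremums (e @` M) xi].

Inductive uniform : omega1 -> set nat -> set (set nat) -> Prop :=
| uniform_zero M : uniform ozero M [set set0]
| uniform_succ zeta M L :
    L `<=` fins M -> ~ L set0 ->
    (forall m, M m -> uniform zeta (M `&` above m) (section M L m)) ->
    uniform (osucc zeta) M L
| uniform_limit xi M L (e : nat -> omega1) :
    olimit xi -> ladder M xi e -> L `<=` fins M -> ~ L set0 ->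
    (forall m, M m -> uniform (e m) (M `&` above m) (section M L m)) ->
    uniform xi M L.

Definition uniform_system (M : set nat) (A : omega1 -> set (set nat)) : Prop :=
  (forall xi, A xi `<=` fins M /\ uniform xi M (A xi)) /\
  (forall xi, ozero < xi ->
     exists e : nat -> omega1,
       [/\ forall zeta, xi = osucc zeta -> forall m, M m -> osucc (e m) = xi,
           olimit xi -> ladder M xi e
         & forall m, M m ->
             section M (A xi) m = A (e m) `&` fins (above m)]).

Definition restr (F : set (set nat)) (M : set nat) : set (set nat) :=
  F `&` fins M.

Definition sderiv1 (M : set nat) (F : set (set nat)) : set (set nat) :=
  [set A | restr F M A /\
     forall L, infs M L -> cluster_point (restr F (A `|` L)) A].

(* The three clauses of the transfinite recursion; see [sderiv_zero],
   [sderiv_succ] and [sderiv_limit]. *)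
Definition sderiv_step (F : set (set nat)) (M : set nat) (xi : omega1)
    (D : forall beta, beta < xi -> set (set nat)) : set (set nat) :=
  [set A | [/\ xi = ozero -> restr F M A,
      forall zeta (h : zeta < xi), xi = osucc zeta -> sderiv1 M (D zeta h) A
    & olimit xi -> forall beta (h : beta < xi), D beta h A]].

Definition sderiv (F : set (set nat)) (M : set nat) : omega1 -> set (set nat) :=
  Fix omega1_wf (fun=> set (set nat)) (@sderiv_step F M).

(* The least [xi] with an empty derivative; an arbitrary value if there is
   none. *)
Definition sindex (F : set (set nat)) (M : set nat) : omega1 :=
  least [set xi | sderiv F M xi = set0].

Lemma osucc_inj : injective osucc.
Proof.
move=> x y e; apply/eqP; rewrite eq_le !leNgt; apply/andP; split; apply/negP.
  by move=> /(osuccP y).2; rewrite -e leNgt (osuccP x).1.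
by move=> /(osuccP x).2; rewrite e leNgt (osuccP y).1.
Qed.

Lemma ozero_neq_osucc x : ozero <> osucc x.
Proof.
by move=> e; have := (osuccP x).1; rewrite -e ltNge ozero_le.
Qed.

Lemma sderivE F M xi :
  sderiv F M xi = @sderiv_step F M xi (fun beta _ => sderiv F M beta).
Proof.
rewrite /sderiv Fix_eq // => x f g fg.
by congr sderiv_step; apply: functional_extensionality_dep => b;
  apply: functional_extensionality_dep => h; exact: fg.
Qed.

Lemma sderiv_zero F M : sderiv F M ozero = restr F M.
Proof.
rewrite sderivE; apply/seteqP; split => A; first by case=> + _ _; exact.
move=> FA; split=> // [z _ /ozero_neq_osucc//|]; by case.
Qed.

Lemma sderiv_succ F M zeta :
  sderiv F M (osucc zeta) = sderiv1 M (sderiv F M zeta).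
Proof.
rewrite sderivE; apply/seteqP; split => A.
  by case=> _ + _; apply => //; exact: (osuccP zeta).1.
move=> DA; split=> [/esym/ozero_neq_osucc//|z _ /osucc_inj <-//|].
by case=> _ /(_ zeta).
Qed.

Lemma sderiv_limit F M xi : olimit xi ->
  sderiv F M xi = \bigcap_(beta in [set b | b < xi]) sderiv F M beta.
Proof.
move=> lxi; rewrite sderivE; apply/seteqP; split => A.
  by case=> _ _ DA beta h; exact: (DA lxi).
move=> DA; split=> [e|z _ e|_ beta h]; last exact: DA.
  by case: lxi.
by case: lxi => _ /(_ z).
Qed.

Definition contains_subsets (F A : set (set nat)) (L : set nat) : Prop :=
  subsets A `&` fins L `<=` F.

Definition below_initials (F A : set (set nat)) (L : set nat) : Prop :=
  F `&` fins L `<=` initials A `\` A.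

Definition is_sup_sindex (F : set (set nat)) (M : set nat) (xi : omega1) :
    Prop :=
  supremums (sindex F @` infs M) xi.

Definition setting (F : set (set nat)) (M : set nat)
    (A : omega1 -> set (set nat)) : Prop :=
  [/\ F `<=` fins Npos, hereditary F, pointwise_closed F,
      infs Npos M & uniform_system M A].

(* Main.v *)
Require Import Defs.
From mathcomp Require Import all_boot all_order.
From mathcomp Require Import boolp classical_sets functions cardinality.
From mathcomp Require Import topology cantor.

Set Implicit Arguments.
Unset Strict Implicit.
Unset Printing Implicit Defensive.
Import Order.TTheory.

Local Open Scope order_scope.
Local Open Scope classical_set_scope.

(** For a hereditary family [F] of finite sets the strong derivative has a
    purely combinatorial description: [A] survives one step relative to [M] if
    and only if [m |` A] is in [F] for all but finitely many [m] in [M]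
    ([sderiv1P]).  Iterating this gives the relation [kern] and the equivalence
    [sderivP]; so for closed [F] and infinite [L] the index is at most
    [xi] if and only if [kern F L xi set0] fails ([sindex_le]).  In this form
    the derivative does not shrink when [L] is thinned out or finitely many
    points are added to it ([kern_almost]), and passing from [F] to the link of a point
    [l] is compatible with it ([kern_link]).

    Three statements about a [xi]-uniform family [A] are proved by induction on
    [xi], and they give the dichotomy:
    - [uniform_kern]: if [F] contains the members of [A] inside [L], then
      [kern F L xi set0];
    - [kern_contains]: if [kern F L (osucc xi) set0], then [F] contains all
      subsets of members of [A] lying in some infinite subset of [L];
    - [dichotomy]: for arbitrary hereditary [F], some infinite subset [L] of a
      given set satisfies one of the two alternatives.
    Each induction passes to the links of [F] and the sections of [A]; in the
    last two, the sets found for the various links are combined by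
    diagonalisation.  If [osucc zeta] is below the supremum of the indices,
    [kern_contains] applies to a set [L] of index larger than [osucc zeta].  If
    the supremum is at most [zeta], the first alternative of [dichotomy] is
    excluded, because [uniform_kern] would make the index on [L] larger than
    [zeta].  If it equals [osucc zeta], it is attained, and [dichotomy] is all
    that is claimed.

    The obstacle is that a subset [t] of a member [s] of [A] may lie in [L]
    while [s] does not.  If [l] is the least element of [t], the part [u] of [s]
    below [l] is arbitrary, but there are only finitely many such [u], and for
    each of them the tail [after A u l] is empty or uniform of a rank below [xi]
    ([after_uniform]), indeed below the rank of the section of [A] at [l] when
    [u] is nonempty ([after_graded]).  So one more diagonalisation disposes of
    all tails ([refine_contains]).

    That the supremum of the indices is countable comes from the closedness of
    [F]: adding points to a member of [F] is a well-founded process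
    ([child_wf]), and the resulting rank of [set0] bounds all indices at once
    ([kern_bounded]).

    For the two instances a system of uniform families on the positive integers
    is built from fundamental sequences.  The first alternative occurs for
    [F = [set set0]] and [zeta = ozero].  The second one occurs when [zeta] is
    the first infinite ordinal, for the family [subschreier]: its members are
    too small to belong to [A zeta], but their sizes are unbounded inside every
    infinite set. *)

(** * Infinite sets of natural numbers *)

Lemma least_nat (P : set nat) : P !=set0 ->
  exists2 m, P m & forall n, P n -> (m <= n)%N.
Proof.
move=> [x Px]; have ex : exists n, `[< P n >] by exists x; apply/asboolP.
case: (ex_minnP ex) => m /asboolP Pm mP.
by exists m => // n Pn; apply/mP/asboolP.
Qed.

Lemma finite_nat_bound (s : set nat) : finite_set s ->
  exists k, forall i, s i -> (i <= k)%N.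
Proof.
move=> /finite_seqP[l ->]; exists (\max_(i <- l) i) => i /= il.
exact: leq_bigmax_seq.
Qed.

Lemma infinite_natP (L : set nat) :
  infinite_set L <-> forall k, exists2 l, L l & (k < l)%N.
Proof.
split=> [Linf k|H /finite_nat_bound[k kP]]; last first.
  by have [l /kP] := H k; rewrite leqNgt => /negP.
apply: contrapT => nex; apply: Linf.
apply: (sub_finite_set (B := `I_k.+1)) => [l Ll /=|]; last exact: finite_II.
by rewrite ltnS leqNgt; apply/negP => kl; apply: nex; exists l.
Qed.

Lemma infs_above M k L : infs M L -> infs M (L `&` above k).
Proof.
move=> [/infinite_natP Linf LM]; split=> [|l [/LM]//].
apply/infinite_natP => j; have [l Ll] := Linf (maxn j k).
by rewrite gtn_max => /andP[jl kl]; exists l.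
Qed.

Lemma infs_refl M L : infs M L -> infs L L.
Proof. by case=> Linf _; split. Qed.

Lemma infs_sub M N L : M `<=` N -> infs M L -> infs N L.
Proof. by move=> MN [Linf LM]; split=> // l /LM /MN. Qed.

Lemma infs_trans M N L : infs N M -> infs M L -> infs N L.
Proof. by move=> [_ MN]; exact: infs_sub. Qed.

Lemma finite_setU1 m (s : set nat) : finite_set s -> finite_set (m |` s).
Proof. by move=> fs; rewrite finite_setU. Qed.

(** A property of all [u] below [n + 1] is a property of all [u] below [n],
    required of [u] and of [n |` u]; this makes the induction work without an
    enumeration of the finite sets. *)
Lemma refine_finitely (R : set nat -> set nat -> Prop) n M K :
    (forall u K K', K' `<=` K -> R u K -> R u K') ->
    (forall u K, u `<=` `I_n -> infs M K -> exists2 K', infs K K' & R u K') ->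
  infs M K -> exists2 K', infs K K' & forall u, u `<=` `I_n -> R u K'.
Proof.
elim: n R M K => [|n IH] R M K Rmono Rex MK.
  have [K' KK' RK'] := Rex set0 K (@sub0set _ _) MK; exists K' => // u u0.
  by have -> : u = set0 by apply/seteqP; split=> // x /u0.
pose R' u K := R u K /\ R (n |` u) K.
have [u K1 K2 K21 [R1 R2]|u K1 un MK1||K' KK' RK'] := IH R' M K.
- by split; apply: Rmono K21 _.
- have un1 : u `<=` `I_n.+1 by move=> i /un /= /ltnW.
  have [K2 K12 R2] := Rex u K1 un1 MK1.
  have [|K3 K23 R3] := Rex (n |` u) K2 _ (infs_trans MK1 K12).
    by move=> i [->|/un/ltnW] //=.
  exists K3; first exact: infs_trans K23.
  by split=> //; apply: Rmono R2; case: K23.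
- exact: MK.
exists K' => // u un; have [nu|nu] := pselect (u n); last first.
  have [|//] := RK' u; move=> i ui /=; have := un i ui.
  rewrite /= ltnS leq_eqVlt => /orP[/eqP ein|//].
  by move: ui; rewrite ein.
have [|_] := RK' (u `\ n); last by rewrite setD1K.
move=> i [ui /= /eqP ni]; have := un i ui.
by rewrite /= ltnS leq_eqVlt (negPf ni).
Qed.

(** * Pointwise convergence *)

Lemma cylinder_nbhs (x : cantor_space) n :
  nbhs x [set y : cantor_space | forall i, (i < n)%N -> y i = x i].
Proof.
elim: n => [|n IH]; first by apply: filterS filterT => y _ i.
have Px : nbhs x [set y : cantor_space | y n = x n].
  apply: (@proj_continuous nat (fun=> bool) n x [set b | b = x n]).
  exact: discrete_set1.
apply: filterS (filterI IH Px) => y [yx yn] i.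
by rewrite ltnS leq_eqVlt => /orP[/eqP->|/yx].
Qed.

Lemma nbhs_cylinder (x : cantor_space) (V : set cantor_space) : nbhs x V ->
  exists n, forall y : cantor_space,
    (forall i, (i < n)%N -> y i = x i) -> V y.
Proof.
(* [G] is the filter generated by the cylinders around [x]. *)
pose G : set_system cantor_space := fun W => exists n, forall y : cantor_space,
  (forall i, (i < n)%N -> y i = x i) -> W y.
have FG : Filter G.
  split=> [|P Q [n nP] [k kQ]|P Q PQ [n nP]].
  - by exists 0.
  - exists (maxn n k) => y yx; split.
      by apply: nP => i ik; apply: yx; rewrite leq_max ik.
    by apply: kQ => i ik; apply: yx; rewrite leq_max ik orbT.
  - by exists n => y /nP /PQ.
suff GX : G --> x by exact: GX.
apply/cvg_sup => i W /=;
  rewrite (@nbhsE (initial_topology (fun f : nat -> bool => f i))).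
  move=> -[B [[O oO <-] /= Ox] BW].
by exists i.+1 => y yx; apply: BW; rewrite /= (yx i).
Qed.

Lemma chiE (A B : set nat) i : (chi A i = chi B i) = (A i <-> B i).
Proof.
apply: propext; split=> [AB|AB]; last exact: (asbool_equiv_eq AB).
exact: (@asbool_eq_equiv (A i) (B i) AB).
Qed.

Lemma chi_inj : injective chi.
Proof.
by move=> A B AB; apply: funext => i; apply/propext; rewrite -chiE AB.
Qed.

Lemma pointwise_closedP F : pointwise_closed F <->
  forall A, (forall n, exists2 B, F B & forall i, (i < n)%N -> (B i <-> A i)) ->
    F A.
Proof.
split=> [clF A apx|H x clx].
  suff [B FB /chi_inj <-//] : (chi @` F) (chi A).
  apply: clF => V /nbhs_cylinder[n nV]; have [B FB BA] := apx n.
  by exists (chi B); split; [exists B|apply: nV => i /BA; rewrite -chiE].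
have xE : x = chi [set i | x i] by apply: funext => i; rewrite /chi asboolb.
exists [set i | x i] => //; apply: H => n.
have [_ [[B FB <-] /= Bx]] := clx _ (cylinder_nbhs x n).
by exists B => // i /Bx; rewrite {1}xE chiE.
Qed.

Lemma cluster_pointP F A : cluster_point F A <->
  forall n, exists B, [/\ F B, B <> A & forall i, (i < n)%N -> (B i <-> A i)].
Proof.
split=> [cA n|H V /nbhs_cylinder[n nV]].
  have [y [/eqP BA [B FB BE] AB]] := cA _ (cylinder_nbhs (chi A) n).
  exists B; split=> // [E|i /AB]; first by apply: BA; rewrite -BE E.
  by rewrite -BE chiE.
have [B [FB BA ABn]] := H n; exists (chi B); split; last 2 first.
- by exists B.
- by apply: nV => i /ABn; rewrite -chiE.
by apply/eqP => /chi_inj.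
Qed.

(** * Countable ordinals *)

Lemma lt_osucc x y : (x < osucc y) = (x <= y).
Proof.
have [lt min] := osuccP y; apply/idP/idP => [|xy]; last exact: le_lt_trans lt.
by apply: contraTT; rewrite -!ltNge -leNgt => /min.
Qed.

Lemma osucc_le x y : (osucc x <= y) = (x < y).
Proof. by rewrite leNgt lt_osucc -ltNge. Qed.

Lemma omega1_ind (P : omega1 -> Prop) :
  (forall x, (forall y, y < x -> P y) -> P x) -> forall x, P x.
Proof. by move=> H x; elim: (omega1_wf x) => y _; exact: H. Qed.

Lemma omega1_cases x : [\/ x = ozero, exists y, x = osucc y | olimit x].
Proof.
have [|x0] := pselect (x = ozero); first by constructor 1.
have [|nex] := pselect (exists y, x = osucc y); first by constructor 2.
by constructor 3; split=> // y xy; apply: nex; exists y.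
Qed.

Lemma omega1_bounded (f : nat -> omega1) : exists b, forall n, f n < b.
Proof.
suff [b bP] : exists b, forall n, f n <= b.
  by exists (osucc b) => n; rewrite lt_osucc.
apply: contrapT => nex; apply: omega1_uncountable.
have -> : [set: omega1] = \bigcup_n [set y | y < f n].
  apply/seteqP; split=> // b _; apply: contrapT => nb; apply: nex.
  exists b => n.
  by rewrite leNgt; apply/negP => bn; apply: nb; exists n.
by apply: bigcup_countable => // n _; exact: omega1_countable_seg.
Qed.

Lemma olimit_osucc l x : olimit l -> x < l -> osucc x < l.
Proof.
move=> [_ l_succ] xl; rewrite lt_neqAle osucc_le xl andbT.
by apply/eqP => /esym; exact: l_succ.
Qed.

Lemma olimit_gt0 l : olimit l -> ozero < l.
Proof. by case=> l0 _; rewrite lt_neqAle ozero_le andbT eq_sym; apply/eqP. Qed.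

(** * The strong derivative as a combinatorial process *)

(** [kern F M xi] is the derivative of order [xi] of [F] relative to [M],
    without the requirement that its members lie in [M].  Quantifying over all
    orders below [xi] replaces the distinction between successors and limits and
    makes monotonicity in [xi] immediate. *)
Inductive kern (F : set (set nat)) (M : set nat) : omega1 -> set nat -> Prop :=
| Kern xi s : F s ->
    (forall b, b < xi ->
       exists k, forall m, M m -> (k < m)%N -> kern F M b (m |` s)) ->
    kern F M xi s.

Lemma kern_in F M xi s : kern F M xi s -> F s.
Proof. by case. Qed.

Lemma kern_lt F M xi b s : kern F M xi s -> b < xi ->
  exists k, forall m, M m -> (k < m)%N -> kern F M b (m |` s).
Proof. by case=> {}xi {}s _ H /H. Qed.

Lemma kern_le F M xi b s : kern F M xi s -> b <= xi -> kern F M b s.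
Proof.
move=> [{}xi {}s Fs H] bxi; apply: Kern => // c cb.
by apply: H; exact: lt_le_trans bxi.
Qed.

Lemma kern_hereditary F M xi : hereditary F -> hereditary (kern F M xi).
Proof.
move=> hF; elim/omega1_ind: xi => xi IH s t ks ts.
apply: Kern => [|b bxi]; first exact: hF (kern_in ks) ts.
have [k kP] := kern_lt ks bxi; exists k => m Mm km.
by apply: IH bxi _ _ (kP m Mm km) _; exact: setUS.
Qed.

(** Only the behaviour for large points of [M] matters, so an order computed
    relative to [M] persists for every [L] almost contained in [M]. *)
Lemma kern_almost F M L k xi s :
  (forall m, L m -> (k < m)%N -> M m) -> kern F M xi s -> kern F L xi s.
Proof.
move=> LM; elim/omega1_ind: xi s => xi IH s ks.
apply: Kern => [|b bxi]; first exact: kern_in ks.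
have [j jP] := kern_lt ks bxi; exists (maxn j k) => m Lm.
by rewrite gtn_max => /andP[jm km]; apply: IH => //; apply: jP => //; exact: LM.
Qed.

Lemma kern_sub F M L xi s : L `<=` M -> kern F M xi s -> kern F L xi s.
Proof. by move=> LM; apply: (@kern_almost _ _ _ 0) => m /LM. Qed.

Definition link (F : set (set nat)) (l : nat) : set (set nat) :=
  [set s | F (l |` s)].

Lemma link_hereditary F l : hereditary F -> hereditary (link F l).
Proof. by move=> hF s t Fs ts; apply: hF Fs _; exact: setUS. Qed.

(** Adding [l] commutes with adding any other point. *)
Lemma kern_link F M l xi s : kern (link F l) M xi s <-> kern F M xi (l |` s).
Proof.
split; elim/omega1_ind: xi s => xi IH s ks;
  (apply: Kern => [|b bxi]; first exact: kern_in ks);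
  have [k kP] := kern_lt ks bxi; exists k => m Mm km.
  by rewrite setUCA; apply: IH => //; exact: kP.
by apply: IH => //; rewrite setUCA; exact: kP.
Qed.

(** If [m |` s] is outside [S] for infinitely many [m] in [M], these [m] form a
    set [L] relative to which [s] is isolated: by heredity a member of [S]
    inside [s `|` L] that agrees with [s] on a long enough initial interval is
    [s].
    Conversely the sets [m |` s] converge to [s] as [m] grows in [L]. *)
Lemma sderiv1P M S s : hereditary S -> S `<=` finite_set ->
  sderiv1 M S s <->
  fins M s /\ S s /\ exists k, forall m, M m -> (k < m)%N -> S (m |` s).
Proof.
move=> hS finS; split=> [[[Ss Ms] cl]|[Ms [Ss [k kP]]]].
  split=> //; split=> //; apply: contrapT => nk.
  pose L := [set m | M m /\ ~ S (m |` s)].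
  have ML : infs M L.
    split=> [|m []//]; apply/infinite_natP => k; apply: contrapT => nL.
    apply: nk; exists k => m Mm km; apply: contrapT => nS; apply: nL.
    by exists m.
  have [b bP] := finite_nat_bound (finS _ Ss).
  have /cluster_pointP/(_ b.+1)[t [[St [_ tsL]] ts agree]] := cl L ML.
  have st : s `<=` t by move=> i si; apply/agree => //; rewrite ltnS bP.
  apply: ts; apply/seteqP; split=> // m tm; apply: contrapT => sm.
  have [//|[_]] := tsL _ tm; apply; apply: hS St _ => i [->//|/st].
  by [].
split=> // L [/infinite_natP Linf LM]; apply/cluster_pointP => n.
have [b bP] := finite_nat_bound (finS _ Ss).
have [m Lm] := Linf (maxn k (maxn n b)).
rewrite !gtn_max => /and3P[km nm bm]; exists (m |` s); split.
- split; first by apply: kP => //; exact: LM.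
  split; first by apply: finite_setU1; exact: finS.
  by move=> i [->|si]; [right|left].
- move=> e; have /bP : s m by rewrite -e; left.
  by rewrite leqNgt bm.
- move=> i im; split=> [[ei|//]|]; last by right.
  by move: im; rewrite ltnNge ei (ltnW nm).
Qed.

Lemma sderivP F M xi s : hereditary F -> F `<=` finite_set ->
  sderiv F M xi s <-> fins M s /\ kern F M xi s.
Proof.
move=> hF finF; elim/omega1_ind: xi s => xi IH s.
have [e|[z e]|lxi] := omega1_cases xi.
- rewrite e sderiv_zero; split=> [[Fs Ms]|[Ms /kern_in//]].
  by split=> //; apply: Kern => // b; rewrite ltNge ozero_le.
- have zxi : z < xi by rewrite e lt_osucc.
  have hS : hereditary (sderiv F M z).
    move=> u v; rewrite !IH // => -[[fu uM] ku] vu; split.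
      by split; [exact: sub_finite_set fu | exact: subset_trans uM].
    exact: kern_hereditary ku vu.
  have finS : sderiv F M z `<=` finite_set by move=> u /IH[]// -[].
  rewrite e sderiv_succ sderiv1P // IH //.
  split=> [[Ms [[_ ks] [k kP]]]|[Ms ks]].
    split=> //; apply: Kern => [|b]; first exact: kern_in ks.
    rewrite lt_osucc => bz; exists k => m Mm km.
    by have /IH[//|_ kz] := kP m Mm km; exact: kern_le bz.
  split=> //; split.
    by split=> //; apply: (kern_le ks); rewrite ltW // lt_osucc.
  have [|k kP] := kern_lt ks (b := z); first by rewrite lt_osucc.
  exists k => m Mm km; apply/IH => //; split; last exact: kP.
  by case: Ms => fs sM; split; [exact: finite_setU1 | move=> i [->|/sM]].
- rewrite sderiv_limit //; split=> [H|[Ms ks] b bxi]; last first.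
    by apply/IH => //; split=> //; apply: kern_le ks (ltW bxi).
  have xi0 := olimit_gt0 lxi.
  have /IH[//|Ms k0] := H _ xi0.
  split=> //; apply: Kern => [|b bxi]; first exact: kern_in k0.
  have sxi := olimit_osucc lxi bxi.
  have /IH[//|_ kb] := H _ sxi.
  by apply: kern_lt kb _; rewrite lt_osucc.
Qed.

Lemma sderiv_eq0 F M xi : hereditary F -> F `<=` finite_set ->
  sderiv F M xi = set0 <-> ~ kern F M xi set0.
Proof.
move=> hF finF; split=> [e k0|nk].
  have : sderiv F M xi set0 by apply/sderivP => //;
    split=> //; split; [exact: finite_set0|].
  by rewrite e.
apply/seteqP; split=> // s /sderivP[]// _ ks; apply: nk.
exact: kern_hereditary ks (@sub0set _ _).
Qed.

(** * A bound for all the indices *)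

Definition child (F : set (set nat)) (t s : set nat) : Prop :=
  F t /\ exists2 m, ~ s m & t = m |` s.

(** An infinite chain of one-point extensions inside [F] would converge to its
    union, an infinite set, which would be in [F] by closedness. *)
Lemma child_wf F : hereditary F -> F `<=` finite_set -> pointwise_closed F ->
  forall s, F s -> Acc (child F) s.
Proof.
move=> hF finF /pointwise_closedP clF s Fs; apply: contrapT => nAcc.
pose bad t := F t /\ ~ Acc (child F) t.
have [g gP] : {g : set nat -> nat &
    forall t, bad t -> ~ t (g t) /\ bad (g t |` t)}.
  apply: (@choice _ _ (fun t m => bad t -> ~ t m /\ bad (m |` t))) => t.
  have [[Ft nt]|nbad] := pselect (bad t); last by exists 0.
  apply: contrapT => nm; apply: nt; constructor => u [Fu [m tm ue]].
  apply: contrapT => nu; apply: nm; exists m => _; rewrite /bad -ue.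
  by [].
pose a n := iter n (fun t => g t |` t) s.
have bada n : bad (a n) by elim: n => [//|n /gP[]].
have amono i j : (i <= j)%N -> a i `<=` a j.
  elim: j => [|j IH]; first by rewrite leqn0 => /eqP->.
  rewrite leq_eqVlt => /orP[/eqP->//|]; rewrite ltnS => /IH ij x /ij.
  by right.
pose U := \bigcup_n a n.
have aU n : a n `<=` U by move=> x ax; exists n.
have fU : finite_set U.
  apply: finF; apply: clF => n.
  suff [j jP] : exists j, forall i, (i < n)%N -> U i -> a j i.
    by exists (a j); [case: (bada j)|move=> i /jP ij; split=> // /aU].
  elim: n => [|n [j jP]]; first by exists 0.
  have [[k _ ak]|nU] := pselect (U n); last first.
    by exists j => i; rewrite ltnS leq_eqVlt => /orP[/eqP->//|/jP].
  exists (maxn j k) => i; rewrite ltnS leq_eqVlt => /orP[/eqP-> _|ij Ui].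
    by apply: amono ak; rewrite leq_maxr.
  by apply: (amono j); [rewrite leq_maxl | exact: jP].
(* The points added along the chain are distinct, so [U] is infinite. *)
have ginj : injective (fun n => g (a n)).
  have lt i j : (i < j)%N -> g (a i) <> g (a j).
    move=> /amono aij e; have [+ _] := gP _ (bada j); apply.
    by rewrite -e; apply: aij; left.
  by move=> i j e; have [/lt//|/lt ji|//] := ltngtP i j; case: ji.
apply: infinite_nat; apply: (@sub_finite_set _ _ ((fun n => g (a n)) @^-1` U)).
  by move=> n _; exists n.+1 => //; left.
by apply: finite_preimage => // i j _ _ /ginj.
Qed.

(** The bound is the rank of [set0] for the well-founded relation [child]: a set
    has countably many children, so its rank can be chosen above theirs, and a
    set in the derivative of order [xi] has children in all the derivatives of
    smaller order. *)
Lemma kern_bounded F : hereditary F -> F `<=` finite_set ->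
  pointwise_closed F ->
  exists r, forall L xi, infinite_set L -> kern F L xi set0 -> xi <= r.
Proof.
move=> hF finF clF.
have [F0|nF0] := pselect (F set0); last by exists ozero => L xi _ /kern_in.
elim: (child_wf hF finF clF F0) => s _ IH.
have [r rP] : {r : nat -> omega1 & forall m L xi, infinite_set L -> ~ s m ->
    kern F L xi (m |` s) -> xi <= r m}.
  apply: (@choice _ _ (fun m r => forall L xi, infinite_set L -> ~ s m ->
    kern F L xi (m |` s) -> xi <= r)) => m.
  have [[Fm sm]|nm] := pselect (F (m |` s) /\ ~ s m).
    have [|r rP] := IH (m |` s); first by split=> //; exists m.
    by exists r => L xi Linf _; exact: rP.
  by exists ozero => L xi _ sm /kern_in Fm; case: nm.
have [b bP] := omega1_bounded r; exists b => L xi Linf ks.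
rewrite leNgt; apply/negP => /(kern_lt ks)[k kP].
have [j jP] := finite_nat_bound (finF _ (kern_in ks)).
have [m Lm] := (infinite_natP L).1 Linf (maxn k j).
rewrite gtn_max => /andP[km jm]; have := bP m; apply/negP; rewrite -leNgt.
apply: rP (kP m Lm km) => // /jP.
by rewrite leqNgt jm.
Qed.

(** * Uniform families and their tails *)

(** The common form of the successor and the limit clause of uniformity: the
    ranks [e m] of the sections are constant in the first case, strictly
    increasing in the second; in both cases they are nondecreasing, and for
    every [b < xi] they are eventually at least [b]. *)
Record graded (xi : omega1) (M : set nat) (A : set (set nat))
    (e : nat -> omega1) : Prop := Graded {
  graded_fins : A `<=` fins M;
  graded_set0 : ~ A set0;
  graded_section : forall m, M m ->
    uniform (e m) (M `&` above m) (section M A m);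
  graded_lt : forall m, M m -> e m < xi;
  graded_le : forall m n, M m -> M n -> (m < n)%N -> e m <= e n;
  graded_cofinal : forall b, b < xi ->
    exists k, forall m, M m -> (k < m)%N -> b <= e m
}.

Lemma uniform_inv xi M A : uniform xi M A ->
  (xi = ozero /\ A = [set set0]) \/ exists e, graded xi M A e.
Proof.
case=> [{}M|z {}M {}A AM A0 unif
  |{}xi {}M {}A e lxi [emono elt [eub elub]] AM A0 unif].
- by left.
- right; exists (fun=> z); split=> // [m _|b]; first by rewrite lt_osucc.
  by rewrite lt_osucc => bz; exists 0.
right; exists e; split=> // [m n Mm Mn mn|b bxi].
  by rewrite ltW ?emono.
have [m Mm bm] : exists2 m, M m & b < e m.
  apply: contrapT => nm; move: bxi; apply/negP; rewrite -leNgt.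
  apply: elub => _ [m Mm <-]; rewrite leNgt; apply/negP => bm.
  by apply: nm; exists m.
exists m => n Mn mn; rewrite ltW // (lt_trans bm) // emono //.
Qed.

Lemma uniform_fins xi M A : uniform xi M A -> A `<=` fins M.
Proof.
move=> /uniform_inv[[_ ->] _ ->|[e /graded_fins//]].
by split; [exact: finite_set0|].
Qed.

(** The iterated section of [A] at the points of [u] and then at [l], for [u]
    below [l]. *)
Definition after (A : set (set nat)) (u : set nat) (l : nat) :
    set (set nat) :=
  [set s | before [set l] s /\ A (u `|` (l |` s))].

Lemma section_after M A l : A `<=` fins M -> section M A l = after A set0 l.
Proof.
move=> AM; apply/seteqP; split=> s.
  by case=> _ As ls; split; rewrite ?set0U.
move=> [ls]; rewrite set0U => As; split=> //.
have [fs sM] := AM _ As; split; last by move=> i si; apply: sM; right.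
by apply: sub_finite_set fs; exact: subsetUr.
Qed.

(** Deleting the least element [m] of [u] turns a tail of [A] into a tail of
    the section of [A] at [m]. *)
Lemma after_section M A u l : A `<=` fins M -> u `<=` `I_l -> u !=set0 ->
    after A u l !=set0 ->
  exists m, [/\ M m, M l, (m < l)%N, u `\ m `<=` `I_l
    & after A u l = after (section M A m) (u `\ m) l].
Proof.
move=> AM ul /least_nat[m um mmin] [t [lt At]]; have ml := ul m um.
have [fin sub] := AM _ At.
exists m; split=> //; [by apply: sub; left|by apply: sub; right; left
  |by move=> i [/ul]|].
have E s : m |` ((u `\ m) `|` (l |` s)) = u `|` (l |` s).
  by rewrite setUA setD1K.
apply/seteqP; split=> s [ls].
  move=> As; split=> //; split; last 2 first.
  - by rewrite E.
  - move=> _ j -> [[uj /= /eqP jm]|[->//|/(ls l j erefl)]].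
      by rewrite ltn_neqAle mmin // andbT eq_sym.
    exact: ltn_trans.
  have [fs sM] := AM _ As; split.
    by apply: sub_finite_set fs; rewrite -[X in _ `<=` X]E => i; right.
  by move=> i is_; apply: sM; rewrite -E; right.
by case=> _; rewrite E => As _; split.
Qed.

(** Taking a section at a point strictly lowers the rank. *)
Lemma after_uniform xi M A u l : uniform xi M A -> u `<=` `I_l ->
    after A u l !=set0 ->
  exists2 eta, eta < xi & uniform eta (M `&` above l) (after A u l).
Proof.
elim/omega1_ind: xi M A u => xi IH M A u unifA ul ne.
have AM := uniform_fins unifA.
have [[_ AE]|[e gA]] := uniform_inv unifA.
  have [s [_]] := ne; rewrite AE /= => e0.
  have : (u `|` (l |` s)) l by right; left.
  by rewrite e0.
have [un0|/nonemptyPn u0] := pselect (u !=set0).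
  have [m [Mm _ ml uml E]] := after_section AM ul un0 ne.
  rewrite E in ne *.
  have [eta em uni] :=
    IH (e m) (graded_lt gA Mm) _ _ _ (graded_section gA Mm) uml ne.
  exists eta; first exact: lt_trans (graded_lt gA Mm).
  suff <- : M `&` above m `&` above l = M `&` above l by [].
  apply/seteqP; split=> [i [[]]//|i [Mi li]]; split=> //; split=> //.
  exact: ltn_trans li.
rewrite u0 -(section_after l AM) in ne *.
have [s [_ /AM[_ sM] _]] := ne; have Ml : M l by apply: sM; left.
by exists (e l); [exact: graded_lt gA _ Ml | exact: graded_section gA _ Ml].
Qed.

(** Let [m] be the least element of [u].  The tail is a tail of the section at
    [m], so its rank is less than [e m], and [e m <= e l] because [m < l]. *)
Lemma after_graded xi M A e u l : graded xi M A e -> u `<=` `I_l ->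
    u !=set0 -> after A u l !=set0 ->
  exists2 eta, eta < e l & uniform eta (M `&` above l) (after A u l).
Proof.
move=> gA ul un0 ne.
have [m [Mm Ml ml uml E]] := after_section (graded_fins gA) ul un0 ne.
rewrite E in ne *.
have [eta em uni] := after_uniform (graded_section gA Mm) uml ne.
exists eta; first exact: lt_le_trans (graded_le gA Mm Ml ml).
suff <- : M `&` above m `&` above l = M `&` above l by [].
apply/seteqP; split=> [i [[]]//|i [Mi li]]; split=> //; split=> //.
exact: ltn_trans li.
Qed.

(** * Diagonalisation and the dichotomy *)

(** Choose [l] in the current infinite set [K], shrink [K] above [l] so that
    [Q l] holds, and repeat; the chosen points form the diagonal set. *)
Lemma diagonal (Q : nat -> set nat -> Prop) L :
    (forall l K K', K' `<=` K -> Q l K -> Q l K') ->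
    infinite_set L ->
    (forall l K, L l -> infs L K -> exists2 K', infs K K' & Q l K') ->
  exists2 L', infs L L' & forall l, L' l -> Q l (L' `&` above l).
Proof.
move=> Qmono Linf Qex; have LL : infs L L by split.
have [f fP] : {f : set nat -> nat * set nat & forall K, infs L K ->
    [/\ K (f K).1, infs (K `&` above (f K).1) (f K).2 & Q (f K).1 (f K).2]}.
  apply: (@choice _ _ (fun K p => infs L K ->
    [/\ K p.1, infs (K `&` above p.1) p.2 & Q p.1 p.2])) => K.
  have [LK|//] := pselect (infs L K); last by exists (0, set0).
  have [l Kl] := infinite_setN0 LK.1.
  have [K' KK' QK'] := Qex l _ (LK.2 l Kl) (infs_above l LK).
  by exists (l, K').
pose K n := iter n (fun K => (f K).2) L; pose l n := (f (K n)).1.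
have LK n : infs L (K n).
  elim: n => [//|n IH]; have [_ KK _] := fP _ IH.
  by apply: infs_sub KK => i [/IH.2].
have Kl n : K n (l n) by have [] := fP _ (LK n).
have Kstep n : K n.+1 `<=` K n `&` above (l n).
  by have [_ [_ KK] _] := fP _ (LK n).
have Kmono i j : (i <= j)%N -> K j `<=` K i.
  elim: j => [|j IH]; first by rewrite leqn0 => /eqP->.
  rewrite leq_eqVlt => /orP[/eqP->//|]; rewrite ltnS => /IH Kij x /Kstep[+ _].
  exact: Kij.
have llt i j : (i < j)%N -> (l i < l j)%N.
  by move=> ij; have /Kstep[] := Kmono _ _ ij _ (Kl j).
exists (range l).
  split=> [|_ [n _ <-]]; last exact: (LK n).2.
  apply/infinite_natP => k; exists (l k.+1); first by exists k.+1.
  elim: k => [|k IH]; first by rewrite (leq_ltn_trans _ (llt 0 1 _)).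
  by rewrite (leq_ltn_trans IH) // llt.
move=> _ [n _ <-]; have [_ _ Qn] := fP _ (LK n).
apply: Qmono Qn => _ [[j _ <-] /= nj].
have : (n < j)%N.
  rewrite ltnNge; apply/negP; rewrite leq_eqVlt => /orP[/eqP e|/llt jn].
    by move: nj; rewrite e /above /= ltnn.
  by move: nj; rewrite /above /= ltnNge (ltnW jn).
by move=> /Kmono; apply.
Qed.

Lemma contains_subsets_sub F A K K' : K' `<=` K ->
  contains_subsets F A K -> contains_subsets F A K'.
Proof.
by move=> KK H s [As [fs sK]]; apply: H; split=> //; split=> // i /sK /KK.
Qed.

Lemma below_initials_sub F A K K' : K' `<=` K ->
  below_initials F A K -> below_initials F A K'.
Proof.
by move=> KK H s [Fs [fs sK]]; apply: H; split=> //; split=> // i /sK /KK.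
Qed.

Lemma contains_subsets_set0 F K : contains_subsets F set0 K.
Proof. by move=> s [[t []]]. Qed.

(** If [t] is a nonempty subset of [s] in [A], with least element [l], then
    [t `\ l] is a subset of [s `&` above l], a member of the tail of [A] after
    [s `&` `I_l] and [l]; and [s `&` `I_l] need not meet [L]. *)
Lemma contains_subsets_of_tails F A L : F set0 ->
    (forall l u, L l -> u `<=` `I_l ->
       contains_subsets (link F l) (after A u l) (L `&` above l)) ->
  contains_subsets F A L.
Proof.
move=> F0 H t [[s As ts] [ft tL]].
have [/least_nat[l tl lmin]|/nonemptyPn->//] := pselect (t !=set0).
suff : link F l (t `\ l) by rewrite /link /= setD1K.
have up i : (t `\ l) i -> (l < i)%N.
  by move=> [ti /= /eqP il]; rewrite ltn_neqAle lmin // andbT eq_sym.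
apply: (H l (s `&` `I_l) (tL _ tl)) => [i []//|]; split; last first.
  split; first by apply: sub_finite_set ft => i [].
  by move=> i til; split; [apply: tL; case: til | exact: up].
exists (s `&` above l) => [|i til]; last first.
  by split; [apply: ts; case: til | exact: up].
split=> [_ j -> []//|].
suff -> : s `&` `I_l `|` (l |` (s `&` above l)) = s by [].
apply/seteqP; split=> i; first by case=> [[]|[->|[]]] //; apply: ts.
by move=> si; have [il|li|->] := ltngtP i l; [left|right; right|right; left].
Qed.

(** For each [l] there are finitely many [u] to treat, so [refine_finitely]
    makes a single infinite set serve all of them, and [diagonal] combines the
    various [l]. *)
Lemma refine_contains F A L : F set0 -> infinite_set L ->
    (forall l u K, L l -> u `<=` `I_l -> infs (L `&` above l) K ->
       exists2 K', infs K K' & contains_subsets (link F l) (after A u l) K') ->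
  exists2 L', infs L L' & contains_subsets F A L'.
Proof.
move=> F0 Linf H.
have [l K K' KK' QK u ul||l K Ll LK|L' LL' QL'] := @diagonal (fun l K =>
  forall u, u `<=` `I_l -> contains_subsets (link F l) (after A u l) K) L.
- exact: contains_subsets_sub KK' (QK u ul).
- exact: Linf.
- have [|||K' KK' QK'] := @refine_finitely
    (fun u K => contains_subsets (link F l) (after A u l) K) l
    (L `&` above l) (K `&` above l).
  + by move=> u K1 K2; exact: contains_subsets_sub.
  + by move=> u K1 ul LK1; exact: H.
  + have [Kinf _] := infs_above l LK; split=> // i [Ki li].
    by split=> //; exact: LK.2.
  by exists K' => //; apply: infs_sub KK' => i [].
exists L' => //; apply: contains_subsets_of_tails => // l u L'l; exact: QL'.
Qed.

(** Almost every [l] in [L] gives [kern (link F l) L xi set0], and each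
    nonempty tail of [A] at [l] has a rank [eta] with [osucc eta <= xi], so the
    induction hypothesis applies to it and to the link. *)
Lemma kern_contains xi M A F L : uniform xi M A -> hereditary F ->
    infs M L -> kern F L (osucc xi) set0 ->
  exists2 L', infs L L' & contains_subsets F A L'.
Proof.
elim/omega1_ind: xi M A F L => xi IH M A F L unifA hF ML kL.
have [|k kP] := kern_lt kL (b := xi); first by rewrite lt_osucc.
have LkL : infs L (L `&` above k) by apply: infs_above (infs_refl ML).
have [|||L' LL' HL'] := @refine_contains F A (L `&` above k).
- exact: kern_in kL.
- by case: LkL.
- move=> l u K [Ll kl] ul LK.
  have [ne|/nonemptyPn->] := pselect (after A u l !=set0); last first.
    by exists K; [exact: infs_refl LK | exact: contains_subsets_set0].
  have [eta eta_xi uni] := after_uniform unifA ul ne.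
  apply: (IH _ eta_xi _ _ _ _ uni).
  + exact: link_hereditary.
  + by apply: infs_sub LK => i [[Li _] li]; split; [exact: ML.2 | exact: li].
  + apply/kern_link; apply: (kern_sub (M := L)) => [i /LK.2[[]]//|].
    by apply: (kern_le (kP l Ll kl)); rewrite osucc_le.
by exists L' => //; exact: infs_sub LL'.
Qed.

(** The section at [l] is [e l]-uniform and its members inside [L] lie in the
    link, whence [kern F L (e l) (l |` set0)]; and the [e l] are cofinal below
    [xi]. *)
Lemma uniform_kern xi M A F L : uniform xi M A -> hereditary F ->
  infs M L -> A `&` fins L `<=` F -> kern F L xi set0.
Proof.
elim/omega1_ind: xi M A F L => xi IH M A F L unifA hF ML AF.
have [[-> AE]|[e gA]] := uniform_inv unifA.
  apply: Kern => [|b]; last by rewrite ltNge ozero_le.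
  by apply: AF; rewrite AE; split=> //; split; [exact: finite_set0|].
have kl l : L l -> kern F L (e l) (l |` set0).
  move=> Ll; have Ml := ML.2 l Ll.
  apply: (@kern_almost _ (L `&` above l) _ l) => [//|]; apply/kern_link.
  apply: (IH _ (graded_lt gA Ml) _ _ _ _ (graded_section gA Ml)).
  - exact: link_hereditary.
  - by have [Linf LM] := infs_above l ML; split=> // i [/ML.2].
  - move=> s [[_ As _] [fs sL]]; apply: AF; split=> //.
    by split; [exact: finite_setU1 | move=> i [->|/sL[]]].
apply: Kern => [|b bxi].
  have [l Ll] := infinite_setN0 ML.1.
  exact: hF (kern_in (kl l Ll)) (@sub0set _ _).
have [k kP] := graded_cofinal gA bxi; exists k => l Ll kl'.
exact: kern_le (kl l Ll) (kP l (ML.2 l Ll) kl').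
Qed.

(** If no member of [A] were inside [L], [uniform_kern] would apply to the empty
    family and put [set0] into it. *)
Lemma uniform_meets xi M A L : uniform xi M A -> infs M L ->
  (A `&` fins L) !=set0.
Proof.
move=> unifA ML; apply: contrapT => /nonemptyPn e.
have h0 : hereditary set0 by [].
by have [|? ? []] := uniform_kern unifA h0 ML; rewrite ?e.
Qed.

Lemma below_initials_of_sections xi M A e F L :
    graded xi M A e -> A !=set0 -> L `<=` M ->
    (forall l, L l ->
       below_initials (link F l) (section M A l) (L `&` above l)) ->
  below_initials F A L.
Proof.
move=> gA [a Aa] LM H t [Ft [ft tL]].
have [/least_nat[l tl lmin]|/nonemptyPn->] := pselect (t !=set0); last first.
  by split; [exists a => //; split=> // i j []|exact: graded_set0 gA].
have up i : (t `\ l) i -> (l < i)%N.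
  by move=> [ti /= /eqP il]; rewrite ltn_neqAle lmin // andbT eq_sym.
have ft' : finite_set (t `\ l) by apply: sub_finite_set ft => i [].
have [|[s [_ As ls] [ts tbef]] nAt] := H l (tL l tl) (t `\ l).
  split; first by rewrite /link /= setD1K.
  by split=> // i til; split; [apply: tL; case: til | exact: up].
split; last first.
  move=> At; apply: nAt; split; last by move=> _ j -> /up.
    by split=> // i [/tL /LM].
  by rewrite setD1K.
exists (l |` s) => //; split.
  by move=> i ti; have [->|il] := pselect (i = l); [left|right; exact: ts].
move=> i j ti [[->|sj] ntj]; first by case: ntj.
have [->|il] := pselect (i = l); first exact: ls.
by apply: tbef => //; split=> // -[/ntj].
Qed.

(** By induction one of the alternatives holds at each [l] for the link and the
    section, on a common diagonal set; one of them holds for infinitely many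
    [l].  If it is the second, it passes to [F] and [A] directly.  If it is the
    first, [uniform_kern] gives the links large derivatives, and then
    [kern_contains] handles the tails with nonempty [u], whose ranks are smaller
    than that of the section at [l].  Those with empty [u] are the sections. *)
Lemma dichotomy xi M A F M1 : uniform xi M A -> hereditary F -> infs M M1 ->
  exists2 L, infs M1 L & contains_subsets F A L \/ below_initials F A L.
Proof.
elim/omega1_ind: xi M A F M1 => xi IH M A F M1 unifA hF MM1.
have [[_ AE]|[e gA]] := uniform_inv unifA.
  exists M1; first exact: infs_refl MM1.
  have [F0|nF0] := pselect (F set0).
    by left; rewrite AE => s [[_ ->]]; rewrite subset0 => -> _.
  by right => s [Fs _]; case: nF0; exact: hF Fs (@sub0set _ _).
pose first l K := contains_subsets (link F l) (section M A l) K.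
pose second l K := below_initials (link F l) (section M A l) K.
have [l K K' KK'||l K M1l M1K|L1 M1L1 QL1] :=
  @diagonal (fun l K => first l K \/ second l K) M1.
- case; first by left; exact: contains_subsets_sub KK' _.
  by right; exact: below_initials_sub KK' _.
- by case: MM1.
- have Ml := MM1.2 l M1l.
  have [|K' KK' QK'] := IH _ (graded_lt gA Ml) _ _ (link F l) (K `&` above l)
      (graded_section gA Ml) (link_hereditary hF).
    have [Kinf _] := infs_above l M1K; split=> // i [Ki li].
    by split=> //; apply: MM1.2; exact: M1K.2.
  by exists K' => //; apply: infs_sub KK' => i [].
pose L2 := [set l | L1 l /\ second l (L1 `&` above l)].
have ML1 := infs_trans MM1 M1L1.
have [L2inf|L2fin] := pselect (infinite_set L2).
  have L12 : infs L1 L2 by split=> // l [].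
  exists L2; first exact: infs_trans M1L1 L12.
  right; apply: (below_initials_of_sections gA).
  - by have [s []] := uniform_meets unifA MM1; exists s.
  - by move=> l [/ML1.2].
  - by move=> l [L1l]; apply: below_initials_sub => i [[]].
(* Above [k] the first alternative holds at every point of [L1]. *)
have [k kP] : exists k, forall l, L2 l -> (l <= k)%N.
  by apply: finite_nat_bound; apply: contrapT.
pose L3 := L1 `&` above k.
have L13 : infs L1 L3 by apply: infs_above (infs_refl M1L1).
have Q3 l : L3 l -> first l (L3 `&` above l).
  move=> [L1l kl]; have [|sec] := QL1 l L1l.
    by apply: contains_subsets_sub => i [[]].
  by have /kP : L2 l by []; rewrite leqNgt kl.
have ML3 := infs_trans ML1 L13.
have k3 l : L3 l -> kern (link F l) (L3 `&` above l) (e l) set0.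
  move=> L3l; have Ml := ML3.2 l L3l.
  apply: (uniform_kern (graded_section gA Ml)).
  - exact: link_hereditary.
  - by have [Linf _] := infs_above l ML3; split=> // i [/ML3.2].
  - by move=> s [As Ls]; apply: (Q3 l L3l); split=> //; exists s.
have [|||L LL HL] := @refine_contains F A L3.
- have [l L3l] := infinite_setN0 ML3.1.
  exact: hF (kern_in (k3 l L3l)) (@sub0set _ _).
- by case: ML3.
- move=> l u K L3l ul LK.
  have [ne|/nonemptyPn->] := pselect (after A u l !=set0); last first.
    by exists K; [exact: infs_refl LK | exact: contains_subsets_set0].
  have [un0|/nonemptyPn->] := pselect (u !=set0); last first.
    exists K; first exact: infs_refl LK.
    rewrite -(section_after l (graded_fins gA)).
    by apply: contains_subsets_sub (Q3 l L3l); case: LK.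
  have [eta eta_el uni] := after_graded gA ul un0 ne.
  apply: (kern_contains uni); first exact: link_hereditary.
    by apply: infs_sub LK => i [/ML3.2].
  apply: (kern_sub LK.2); apply: (kern_le (k3 l L3l)).
  by rewrite osucc_le.
exists L; last by left.
exact: infs_trans (infs_trans M1L1 L13) LL.
Qed.

(** * Indices and their supremum *)

Lemma sindex_le F L x : hereditary F -> F `<=` finite_set ->
    (exists eta, sderiv F L eta = set0) ->
  sindex F L <= x <-> ~ kern F L x set0.
Proof.
move=> hF finF ne; have [s0 smin] := leastP ne; split=> [sx kx|nk].
  by move/sderiv_eq0 : s0 => /(_ hF finF); apply; exact: kern_le kx sx.
by apply: smin; apply/sderiv_eq0.
Qed.

Lemma sindex_osucc F L z : hereditary F -> F `<=` finite_set ->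
  kern F L z set0 -> ~ kern F L (osucc z) set0 -> sindex F L = osucc z.
Proof.
move=> hF finF kz nk.
have ne : exists eta, sderiv F L eta = set0.
  by exists (osucc z); apply/sderiv_eq0.
apply/eqP; rewrite eq_le osucc_le ltNge; apply/andP; split.
  exact/sindex_le.
by apply/negP => /sindex_le; apply.
Qed.

Lemma contains_subsetsW F A L : contains_subsets F A L -> A `&` fins L `<=` F.
Proof. by move=> H s [As Ls]; apply: H; split=> //; exists s. Qed.

Lemma dichotomy_of_setting F M A : setting F M A ->
  (forall L, infs M L -> exists eta, sderiv F L eta = set0) /\
  exists xi : omega1,
    [/\ is_sup_sindex F M xi,
        forall zeta, osucc zeta < xi ->
          exists2 L, infs M L & contains_subsets F (A zeta) L,
        forall zeta, xi < osucc zeta -> forall M1, infs M M1 ->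
          exists2 L, infs M1 L &
            below_initials F (A zeta) L /\
            A zeta `&` fins L `<=` fins Npos `\` F
      & forall zeta, xi = osucc zeta ->
          exists2 M1, infs M M1 &
            sindex F M1 = xi /\
            exists2 L, infs M1 L &
              contains_subsets F (A zeta) L \/ below_initials F (A zeta) L].
Proof.
move=> [FN hF clF [Minf MN] [unifA _]].
have finF : F `<=` finite_set by move=> s /FN[].
have [r rP] := kern_bounded hF finF clF.
have vanish L : infs M L -> exists eta, sderiv F L eta = set0.
  move=> [Linf _]; exists (osucc r); apply/sderiv_eq0 => // /(rP _ _ Linf).
  by rewrite osucc_le ltxx.
have sle L x : infs M L -> sindex F L <= x <-> ~ kern F L x set0.
  by move=> /vanish; exact: sindex_le.
split=> //; pose S := sindex F @` infs M.
have [|ubS lubS] := @leastP (ubound S).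
  exists (osucc r) => _ [L ML <-]; apply/sle => // /(rP _ _ ML.1).
  by rewrite osucc_le ltxx.
exists (least (ubound S)); split=> // [z zS|z zS M1 MM1|z zS].
- have [L ML zL] : exists2 L, infs M L & osucc z < sindex F L.
    apply: contrapT => nL; move: zS; apply/negP; rewrite -leNgt.
    apply: lubS => _ [L ML <-]; rewrite leNgt; apply/negP => zL.
    by apply: nL; exists L.
  have kz : kern F L (osucc z) set0.
    by apply: contrapT => /sle; rewrite leNgt zL => /(_ ML).
  have [L' LL' HL'] := kern_contains (unifA z).2 hF ML kz.
  by exists L' => //; exact: infs_trans LL'.
- have [L M1L HL] := dichotomy (unifA z).2 hF MM1.
  have ML := infs_trans MM1 M1L.
  have below : below_initials F (A z) L.
    case: HL => // /contains_subsetsW/(uniform_kern (unifA z).2 hF ML).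
    suff /sle : sindex F L <= z by move=> /(_ ML).
    by rewrite -lt_osucc (le_lt_trans _ zS) //; apply: ubS; exists L.
  exists L => //; split=> // s [As Ls]; split.
    by have [fs sM] := (unifA z).1 s As; split=> // i /sM /MN.
  by move=> Fs; have [|_] := below s.
have [M1 MM1 zM1] : exists2 L, infs M L & z < sindex F L.
  apply: contrapT => nL; have : least (ubound S) <= z.
    apply: lubS => _ [L ML <-]; rewrite leNgt; apply/negP => zL.
    by apply: nL; exists L.
  by rewrite zS osucc_le ltxx.
exists M1 => //; split; last exact: dichotomy (unifA z).2 hF MM1.
apply/eqP; rewrite eq_le {2}zS osucc_le zM1 andbT.
by apply: ubS; exists M1.
Qed.

(** * A system of uniform families *)

(** Enumerate the ordinals below [xi] and pass to successors of maxima. *)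
Lemma limit_sequence xi : olimit xi -> exists e : nat -> omega1,
  [/\ forall m n, (m < n)%N -> e m < e n, forall n, e n < xi
    & forall b, b < xi -> exists n, b < e n].
Proof.
move=> lxi; have /pcard_injP[g ginj] := omega1_countable_seg xi.
have [f fP] : {f : nat -> omega1 & forall n, f n < xi /\
    forall b, b < xi -> g b = n -> f n = b}.
  apply: (@choice _ _ (fun n y => y < xi /\
    forall b, b < xi -> g b = n -> y = b)) => n.
  have [[b [bxi bn]]|nb] := pselect (exists b, b < xi /\ g b = n); last first.
    exists ozero; split; first exact: olimit_gt0.
    by move=> b bxi bn; case: nb; exists b.
  by exists b; split=> // c cxi cn; apply: ginj; rewrite ?inE // bn cn.
pose e n := iteri n (fun i x => osucc (Order.max x (f i))) ozero.
have eS n : e n.+1 = osucc (Order.max (e n) (f n)) by [].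
have elt n : e n < e n.+1 by rewrite eS lt_osucc le_max lexx.
exists e; split=> [m n|n|b bxi].
- elim: n => // n IH; rewrite ltnS leq_eqVlt => /orP[/eqP->//|/IH mn].
  exact: lt_trans (elt n).
- elim: n => [|n IH]; first exact: olimit_gt0.
  by rewrite eS olimit_osucc // gt_max IH (fP n).1.
exists (g b).+1; have [_ /(_ b bxi erefl) fb] := fP (g b).
by rewrite eS lt_osucc le_max fb lexx orbT.
Qed.

Definition fundamental (E : omega1 -> nat -> omega1) : Prop :=
  (forall z m, E (osucc z) m = z) /\
  forall xi, olimit xi ->
    [/\ forall m n, (m < n)%N -> E xi m < E xi n, forall n, E xi n < xi
      & forall b, b < xi -> exists n, b < E xi n].

Lemma fundamental_exists : exists E, fundamental E.
Proof.
have [E EP] : {E : omega1 -> nat -> omega1 & forall xi,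
    (forall z m, xi = osucc z -> E xi m = z) /\
    (olimit xi -> [/\ forall m n, (m < n)%N -> E xi m < E xi n,
      forall n, E xi n < xi & forall b, b < xi -> exists n, b < E xi n])}.
  apply: (@choice _ _ (fun xi e => (forall z m, xi = osucc z -> e m = z) /\
    (olimit xi -> [/\ forall m n, (m < n)%N -> e m < e n,
      forall n, e n < xi & forall b, b < xi -> exists n, b < e n]))) => xi.
  have [x0|[z xz]|lxi] := omega1_cases xi.
  - exists (fun=> ozero); split=> [z m|[]//].
    by rewrite x0 => /ozero_neq_osucc.
  - exists (fun=> z); split=> [y m|[_ /(_ z)//]].
    by rewrite xz => /osucc_inj.
  - have [e eP] := limit_sequence lxi; exists e; split=> // z m xz.
    by case: lxi => _ /(_ z).
by exists E; split=> [z m|xi]; [exact: (EP (osucc z)).1 | exact: (EP xi).2].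
Qed.

(** Removing the least element [m] of a member of [std E xi] leaves a member of
    [std E (E xi m)], so the sections of these families are traces of families
    of the same collection, and coherence holds by construction. *)
Inductive std (E : omega1 -> nat -> omega1) : omega1 -> set nat -> Prop :=
| std_zero : std E ozero set0
| std_cons xi m s : ozero < xi -> (0 < m)%N -> before [set m] s ->
    std E (E xi m) s -> std E xi (m |` s).

Lemma setU1_neq0 m (s : set nat) : m |` s <> set0.
Proof. by move=> e; suff : set0 m by []; rewrite -e; left. Qed.

Lemma setU1_before_inj m n (s t : set nat) : before [set m] s ->
  before [set n] t -> m |` s = n |` t -> m = n /\ s = t.
Proof.
move=> ms nt e.
have mn : m = n.
  have [//|mt] : (n |` t) m by rewrite -e; left.
  have [//|ns] : (m |` s) n by rewrite e; left.
  by have := ltn_trans (ms m n erefl ns) (nt n m erefl mt); rewrite ltnn.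
split=> //; rewrite -{n}mn in nt e.
have sub (u v : set nat) : before [set m] u -> m |` u = m |` v -> u `<=` v.
  move=> mu uv i ui; have [im|//] : (m |` v) i by rewrite -uv; right.
  by have := mu m i erefl ui; rewrite im ltnn.
by apply/seteqP; split; [exact: sub e | exact: sub nt (esym e)].
Qed.

Lemma std_fins E xi : std E xi `<=` fins Npos.
Proof.
move=> s; elim=> [|{}xi m {}s _ m0 _ _ [fs sN]].
  by split; [exact: finite_set0 |].
by split; [exact: finite_setU1 | move=> i [->|/sN]].
Qed.

Lemma std_ozero E : std E ozero = [set set0].
Proof.
apply/seteqP; split=> [s H|_ ->]; last exact: std_zero.
move Ex : ozero H => x H; case: H Ex => // xi m t + _ _ _ e.
by rewrite e ltxx.
Qed.

Lemma std_set0 E xi : ozero < xi -> ~ std E xi set0.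
Proof.
move=> xi0; move Es : set0 => s H; case: H xi0 Es => [|{}xi m {}s _ _ _ _ _].
  by rewrite ltxx.
by move=> /esym/setU1_neq0.
Qed.

Lemma std_consE E xi m s : ozero < xi -> (0 < m)%N -> before [set m] s ->
  std E xi (m |` s) <-> std E (E xi m) s.
Proof.
move=> xi0 m0 ms; split=> [H|]; last exact: std_cons.
move Et : (m |` s) H => t H.
case: H xi0 Et => [_ /setU1_neq0//|{}xi n {}t _ n0 nt H _ e].
by have [-> ->] := setU1_before_inj ms nt e.
Qed.

Lemma std_section E xi k m : ozero < xi -> above k m ->
  section (above k) (std E xi `&` fins (above k)) m =
  std E (E xi m) `&` fins (above m).
Proof.
move=> xi0 km; have m0 : (0 < m)%N by apply: leq_ltn_trans km.
apply/seteqP; split=> s.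
  move=> [[fs sk] [As _] ms]; split; first exact/std_consE.
  by split=> // i; exact: ms.
move=> [As [fs sm]]; have ms : before [set m] s by move=> _ j -> /sm.
have sk : s `<=` above k by move=> i /sm; exact: ltn_trans.
split=> //; split; first exact/std_consE.
by split; [exact: finite_setU1 | move=> i [->|/sk]].
Qed.

Lemma above_above k m : above k m -> above k `&` above m = above m.
Proof.
move=> km; apply/seteqP; split=> [i []//|i mi]; split=> //.
exact: ltn_trans mi.
Qed.

Lemma ladder_above E xi k : fundamental E -> olimit xi ->
  ladder (above k) xi (E xi).
Proof.
move=> [_ /(_ xi)+] lxi => /(_ lxi)[Emono Elt Ecof].
split=> [m n _ _|m _|]; [exact: Emono | exact: Elt | split].
  by move=> _ [m _ <-]; exact: ltW.
move=> b bub; rewrite leNgt; apply/negP => /Ecof[n bn].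
have nk : (n < (maxn n k).+1)%N by rewrite ltnS leq_maxl.
have : E xi (maxn n k).+1 <= b.
  by apply: bub; exists (maxn n k).+1 => //; rewrite /above /= ltnS leq_maxr.
by rewrite leNgt (lt_trans bn (Emono _ _ nk)).
Qed.

(** The sets [above k] are the only base sets that arise when sections are
    taken repeatedly, so the induction is carried out for all [k] at once. *)
Lemma std_uniform E xi k : fundamental E ->
  uniform xi (above k) (std E xi `&` fins (above k)).
Proof.
move=> fE; elim/omega1_ind: xi k => xi IH k.
have sub : std E xi `&` fins (above k) `<=` fins (above k) by move=> s [].
have no0 : ozero < xi -> ~ (std E xi `&` fins (above k)) set0.
  by move=> xi0 [/(std_set0 xi0)].
have [e|[z e]|lxi] := omega1_cases xi.
- suff -> : std E xi `&` fins (above k) = [set set0].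
    by rewrite e; exact: uniform_zero.
  rewrite e std_ozero; apply/seteqP; split=> [s []//|s ->]; split=> //.
  by split; [exact: finite_set0|].
- have xi0 : ozero < xi by rewrite e lt_osucc ozero_le.
  have E1 m : E xi m = z by rewrite e fE.1.
  rewrite [X in uniform X]e; apply: uniform_succ => //; first exact: no0.
  move=> m km; rewrite std_section // above_above // E1; apply: IH.
  by rewrite e lt_osucc.
- have xi0 := olimit_gt0 lxi.
  apply: (uniform_limit lxi (ladder_above k fE lxi)) => //; first exact: no0.
  move=> m km; rewrite std_section // above_above //; apply: IH.
  by have [] := fE.2 _ lxi.
Qed.

Lemma uniform_system_exists : exists A, uniform_system Npos A.
Proof.
have [E fE] := fundamental_exists; exists (std E).
have stdN xi : std E xi `&` fins Npos = std E xi.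
  by apply/seteqP; split=> [s []//|s As]; split=> //; exact: std_fins As.
split=> [xi|xi xi0].
  by split; [exact: std_fins | rewrite -stdN; exact: std_uniform].
exists (E xi); split=> [z -> m _||m m0]; first by rewrite fE.1.
  exact: ladder_above.
by rewrite -{1}stdN std_section.
Qed.

(** * Instances of the two alternatives *)

Lemma infs_Npos : infs Npos Npos.
Proof. by split=> //; apply/infinite_natP => k; exists k.+1. Qed.

Lemma uniform_ozero M A : infinite_set M -> uniform ozero M A ->
  A = [set set0].
Proof.
move=> /infinite_setN0[m Mm] /uniform_inv[[]//|[e gA]].
by have := graded_lt gA Mm; rewrite ltNge ozero_le.
Qed.

Lemma sup_sindex_const F M z : hereditary F -> F `<=` finite_set ->
    infinite_set M ->
    (forall L, infs M L -> kern F L z set0 /\ ~ kern F L (osucc z) set0) ->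
  is_sup_sindex F M (osucc z) /\ sindex F M = osucc z.
Proof.
move=> hF finF Minf H.
have sE L : infs M L -> sindex F L = osucc z.
  by move=> /H[kz nk]; exact: sindex_osucc.
have MM : infs M M by split.
split; last exact: sE.
split=> [_ [L ML <-]|b]; first by rewrite sE.
by apply; exists M => //; exact: sE.
Qed.

Lemma first_alternative_occurs :
  exists (F : set (set nat)) (M : set nat) (A : omega1 -> set (set nat))
      (zeta : omega1),
    [/\ setting F M A, is_sup_sindex F M (osucc zeta)
      & exists2 M1, infs M M1 &
          sindex F M1 = osucc zeta /\
          exists2 L, infs M1 L & contains_subsets F (A zeta) L].
Proof.
have [A sysA] := uniform_system_exists.
pose F : set (set nat) := [set set0].
have hF : hereditary F by move=> s t ->; rewrite subset0.
have finF : F `<=` finite_set by move=> s ->; exact: finite_set0.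
have index L : infs Npos L ->
    kern F L ozero set0 /\ ~ kern F L (osucc ozero) set0.
  move=> [Linf _]; split; first by apply: Kern => // b; rewrite ltNge ozero_le.
  move=> /kern_lt/(_ (osuccP ozero).1)[k kP].
  have [m Lm km] := (infinite_natP L).1 Linf k.
  by have /kern_in/setU1_neq0 := kP m Lm km.
have [sup s1] := sup_sindex_const hF finF infs_Npos.1 index.
exists F, Npos, A, ozero; split=> //.
  split=> //; last exact: infs_Npos.
    by move=> s ->; split; [exact: finite_set0|].
  apply/pointwise_closedP => B HB; apply/seteqP; split=> // i Bi.
  have [_ -> agree] := HB i.+1; exact/agree.
exists Npos; first exact: infs_Npos.
split=> //; exists Npos; first exact: infs_Npos.
rewrite (uniform_ozero infs_Npos.1 (sysA.1 ozero).2).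
by move=> s [[_ ->]]; rewrite subset0.
Qed.

Definition onat (n : nat) : omega1 := iter n osucc ozero.

Lemma onat_lt m n : (m < n)%N -> onat m < onat n.
Proof.
elim: n => // n IH; rewrite ltnS leq_eqVlt /= lt_osucc => /orP[/eqP->//|/IH].
exact: ltW.
Qed.

Lemma le_onat n x : x <= onat n -> exists k, x = onat k.
Proof.
elim: n x => [|n IH] x xn.
  by exists 0; apply/eqP; rewrite eq_le xn ozero_le.
move: xn; rewrite le_eqVlt => /orP[/eqP->|]; first by exists n.+1.
by rewrite lt_osucc => /IH.
Qed.

Lemma omega_exists : exists w, [/\ olimit w, forall n, onat n < w
  & forall x, x < w -> exists n, x = onat n].
Proof.
have [|wP wmin] := @leastP [set x | forall n, onat n < x].
  by have [b bP] := omega1_bounded onat; exists b.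
set w := least _ in wP wmin.
have below x : x < w -> exists n, x = onat n.
  move=> xw; have [n /le_onat//] : exists n, x <= onat n.
  apply: contrapT => nx; move: xw; apply/negP; rewrite -leNgt.
  apply: wmin => n; rewrite ltNge; apply/negP => xn.
  by apply: nx; exists n.
exists w; split=> //; split=> [w0|x wx].
  by have := wP 0; rewrite w0 ltxx.
have [|n xn] := below x; first by rewrite wx lt_osucc.
by have := wP n.+1; rewrite wx xn ltxx.
Qed.

Lemma uniform_osucc_inv z M A : uniform (osucc z) M A ->
  forall m, M m -> uniform z (M `&` above m) (section M A m).
Proof.
move Ex : (osucc z) => x H;
  case: H Ex => [{}M|y {}M {}A _ _ unif|xi {}M {}A e lxi _ _ _ _].
- by move=> /esym/ozero_neq_osucc.
- by move=> /osucc_inj ->.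
- by move=> /esym; case: lxi => _ /(_ z).
Qed.

Lemma uniform_onat_size n M A s : uniform (onat n) M A -> A s ->
  exists l : seq nat, [/\ uniq l, size l = n & forall i, i \in l -> s i].
Proof.
elim: n M A s => [|n IH] M A s unifA As; first by exists [::].
have [[/esym/ozero_neq_osucc//]|[e gA]] := uniform_inv unifA.
have [/least_nat[m sm mmin]|/nonemptyPn s0] := pselect (s !=set0); last first.
  by case: (graded_set0 gA); rewrite -s0.
have [fs sM] := graded_fins gA As.
have [|l [ul sl ls]] := IH _ _ (s `\ m) (uniform_osucc_inv unifA (sM m sm)).
  split; last 2 first.
  - by rewrite setD1K.
  - by move=> _ j -> [sj /= /eqP jm]; rewrite ltn_neqAle mmin // eq_sym jm.
  by split; [apply: sub_finite_set fs => i [] | move=> i [/sM]].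
exists (m :: l); split=> /=; [|by rewrite sl|].
  by rewrite ul andbT; apply/negP => /ls[_]; apply.
by move=> i; rewrite inE => /orP[/eqP->//|/ls[]].
Qed.

Lemma infinite_uniq_seq (S : set nat) n : infinite_set S ->
  exists l : seq nat, [/\ uniq l, size l = n & forall i, i \in l -> S i].
Proof.
move=> /infinite_natP Sinf; elim: n => [|n [l [ul sl lS]]].
  by exists [::].
have [k Sk lk] := Sinf (\max_(i <- l) i).
exists (k :: l); split=> /=; [|by rewrite sl|].
  rewrite ul andbT; apply/negP => kl; move: lk; apply/negP; rewrite -leqNgt.
  exact: leq_bigmax_seq.
by move=> i; rewrite inE => /orP[/eqP->//|/lS].
Qed.

(** The finite sets [s] of positive integers with fewer than [m] elements, for
    every [m] in [s].  Cardinality is expressed through duplicate-free lists of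
    elements of [s], so that closedness is visible: each instance of the
    condition concerns finitely many points. *)
Definition subschreier : set (set nat) :=
  [set s | s `<=` Npos /\ forall m (l : seq nat), s m -> uniq l ->
     (forall i, i \in l -> s i) -> (size l < m)%N].

Lemma subschreier_finite : subschreier `<=` finite_set.
Proof.
move=> s [_ small]; apply: contrapT => sinf.
have [m sm] := infinite_setN0 sinf.
have [l [ul sl ls]] := infinite_uniq_seq m sinf.
by have := small m l sm ul ls; rewrite sl ltnn.
Qed.

Lemma subschreier_hereditary : hereditary subschreier.
Proof.
move=> s t [sN small] ts; split=> [i /ts/sN//|m l tm ul lt].
by apply: small => // [|i /lt/ts]; first exact: ts.
Qed.

Lemma subschreier_closed : pointwise_closed subschreier.
Proof.
apply/pointwise_closedP => s apx; split=> [i si|m l sm ul ls].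
  have [t [tN _] ts] := apx i.+1.
  by apply/tN/ts.
have [t [_ small] ts] := apx (maxn m (\max_(i <- l) i)).+1.
apply: small => // [|i il]; first by apply/ts => //; rewrite ltnS leq_maxl.
apply/ts; last exact: ls.
by rewrite ltnS leq_max leq_bigmax_seq ?orbT.
Qed.

(** Adding a large point to [l] uses up one of the [n] spare places. *)
Lemma subschreier_kern_onat L n (l : seq nat) :
    (forall i, i \in l -> (size l + n < i)%N) ->
  kern subschreier L (onat n) [set` l].
Proof.
elim: n l => [|n IH] l ln; apply: Kern.
- split=> [i /ln|m l' /ln ml ul' l'l]; first exact: leq_ltn_trans.
  by rewrite (leq_ltn_trans (uniq_leq_size ul' l'l)) // -[size l]addn0.
- by move=> b; rewrite ltNge ozero_le.
- split=> [i /ln|m l' /ln ml ul' l'l]; first exact: leq_ltn_trans.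
  rewrite (leq_ltn_trans (uniq_leq_size ul' l'l)) //.
  exact: leq_ltn_trans (leq_addr _ _) ml.
move=> b; rewrite lt_osucc => bn; exists (size l + n.+1)%N => m _ lm.
apply: kern_le bn; have -> : m |` [set` l] = [set` (m :: l)].
  apply/seteqP; split=> i /=; rewrite inE.
    by case=> [->|->]; rewrite ?eqxx ?orbT.
  by case/orP => [/eqP->|il]; [left|right].
apply: IH => i; rewrite inE /= addSnnS => /orP[/eqP->//|].
exact: ln.
Qed.

(** Let [w] be the first infinite ordinal.  A member of [A w] with least element
    [m] has at least [k + 1] elements, where the finite rank [k] of the section
    at [m] is at least [m - 1]; so no member of [A w] is in [subschreier].  This
    rules out the first alternative on every infinite set, hence also, by
    [kern_contains], a nonempty derivative of order [osucc w]; but all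
    derivatives of finite order contain [set0]. *)
Lemma second_alternative_occurs :
  exists (F : set (set nat)) (M : set nat) (A : omega1 -> set (set nat))
      (zeta : omega1),
    [/\ setting F M A, is_sup_sindex F M (osucc zeta)
      & exists2 M1, infs M M1 &
          sindex F M1 = osucc zeta /\
          exists2 L, infs M1 L & below_initials F (A zeta) L].
Proof.
have [A sysA] := uniform_system_exists.
have [w [lw ltw below]] := omega_exists.
have hF := subschreier_hereditary; have finF := subschreier_finite.
have w0 := olimit_gt0 lw.
have disj s : A w s -> ~ subschreier s.
  move=> As [sN small].
  have [e [_ /(_ lw)[emono elt _] sec]] := sysA.2 w w0.
  have [[e0]|[e' gA]] := uniform_inv (sysA.1 w).2.
    by move: w0; rewrite e0 ltxx.
  have [/least_nat[m sm mmin]|/nonemptyPn s0] := pselect (s !=set0); last first.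
    by case: (graded_set0 gA); rewrite -s0.
  have [fs _] := graded_fins gA As.
  have em n : onat n <= e n.+1.
    elim: n => [|n IH]; first exact: ozero_le.
    by rewrite /= osucc_le (le_lt_trans IH) // emono.
  have m0 := sN m sm.
  have [k ek] := below _ (elt m m0).
  have mk : (m <= k.+1)%N.
    rewrite leqNgt; apply/negP => km; have := em m.-1.
    rewrite prednK // ek leNgt onat_lt //.
    by rewrite -ltnS prednK.
  have [smA _] : (A (e m) `&` fins (above m)) (s `\ m).
    rewrite -sec //; split; last 2 first.
    - by rewrite setD1K.
    - by move=> _ j -> [sj /= /eqP jm]; rewrite ltn_neqAle mmin // eq_sym jm.
    by split; [apply: sub_finite_set fs => i [] | move=> i [/sN]].
  have unifm := (sysA.1 (e m)).2; rewrite ek in unifm smA.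
  have [l [ul sl ls]] := uniform_onat_size unifm smA.
  have : (size (m :: l) < m)%N.
    apply: small => // [|i]; rewrite /= ?ul ?andbT.
      by apply/negP => /ls[_]; apply.
    by rewrite inE => /orP[/eqP->//|/ls[]].
  by rewrite /= sl ltnNge mk.
have nocontain L : infs Npos L -> ~ contains_subsets subschreier (A w) L.
  move=> NL /contains_subsetsW H.
  have [s [As Ls]] := uniform_meets (sysA.1 w).2 NL.
  by apply: (disj s As); apply: H.
have index L : infs Npos L ->
    kern subschreier L w set0 /\ ~ kern subschreier L (osucc w) set0.
  move=> NL; split; last first.
    move=> /(kern_contains (sysA.1 w).2 hF NL)[L' LL'].
    exact: nocontain (infs_trans NL LL').
  apply: Kern => [|b /below[n ->]]; first by split.
  exists n.+1 => m _ nm.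
  have -> : m |` set0 = [set` [:: m]].
    by rewrite setU0; apply/seteqP; split=> i /=; rewrite inE => /eqP.
  by apply: subschreier_kern_onat => i; rewrite inE => /eqP->.
have [sup s1] := sup_sindex_const hF finF infs_Npos.1 index.
exists subschreier, Npos, A, w; split=> //.
  split=> //; [|exact: subschreier_closed|exact: infs_Npos].
  by move=> s Fs; split; [exact: finF|case: Fs].
exists Npos; first exact: infs_Npos.
split=> //.
have [L NL HL] := dichotomy (sysA.1 w).2 hF infs_Npos.
by exists L => //; case: HL => // /(nocontain L NL).
Qed.

Theorem mainTheorem4 :
  (forall (F : set (set nat)) (M : set nat) (A : omega1 -> set (set nat)),
     setting F M A ->
     (forall L, infs M L -> exists eta, sderiv F L eta = set0) /\
     exists xi : omega1,
       [/\ is_sup_sindex F M xi,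
           forall zeta, osucc zeta < xi ->
             exists2 L, infs M L & contains_subsets F (A zeta) L,
           forall zeta, xi < osucc zeta -> forall M1, infs M M1 ->
             exists2 L, infs M1 L &
               below_initials F (A zeta) L /\
               A zeta `&` fins L `<=` fins Npos `\` F
         & forall zeta, xi = osucc zeta ->
             exists2 M1, infs M M1 &
               sindex F M1 = xi /\
               exists2 L, infs M1 L &
                 contains_subsets F (A zeta) L \/ below_initials F (A zeta) L])
  /\
  (exists (F : set (set nat)) (M : set nat) (A : omega1 -> set (set nat))
      (zeta : omega1),
     [/\ setting F M A, is_sup_sindex F M (osucc zeta)
       & exists2 M1, infs M M1 &
           sindex F M1 = osucc zeta /\
           exists2 L, infs M1 L & contains_subsets F (A zeta) L])
  /\
  (exists (F : set (set nat)) (M : set nat) (A : omega1 -> set (set nat))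
      (zeta : omega1),
     [/\ setting F M A, is_sup_sindex F M (osucc zeta)
       & exists2 M1, infs M M1 &
           sindex F M1 = osucc zeta /\
           exists2 L, infs M1 L & below_initials F (A zeta) L]).
Proof.
split; first exact: dichotomy_of_setting.
by split; [exact: first_alternative_occurs | exact: second_alternative_occurs].
Qed.
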